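(* Let $I$ be the two-sided ideal of $\mathcal U$ consisting of all elements that act as zero on $\mathbf C[\mathbf Y]$, and let $J$ be the two-sided ideal of $\mathcal U$ generated by the elements \begin{align*} &u_iu_j-u_ju_i \quad (|i-j|\ge 2),\qquad d_id_j-d_jd_i \quad (|i-j|\ge 2),\qquad d_iu_j-u_jd_i \quad (i\neq j),\\ &d_1u_1-1,\qquad d_{i+1}u_{i+1}-u_id_i \quad (i\ge 1), \end{align*} where all indices range over positive integers. Then $I=J$. Equivalently, the algebra $\mathcal U/I$ generated by the operators $u_i,d_i$ on $\mathbf C[\mathbf Y]$ is presented by these quadratic relations.
   Context: A partition $\lambda=(\lambda_1,\lambda_2,\dots)$ is a nonincreasing sequence of nonnegative integers with finite sum; $\lambda'$ denotes the conjugate partition, so $\lambda'_i$ is the number of boxes in column $i$ of the Young diagram. Let $\mathbf Y$ be the set of all partitions and $\mathbf C[\mathbf Y]$ the complex vector space with basis $\mathbf Y$. Let $\Gamma=\{1,2,\dots\}\cup\{\bar 1,\bar 2,\dots\}$ and let $\mathcal U$ be the free associative $\mathbf C$-algebra on generators $u_a$, $a\in\Gamma$; write $d_i=u_{\bar i}$. $\mathcal U$ acts on $\mathbf C[\mathbf Y]$ (products act as compositions of operators) via: for $\lambda\in\mathbf Y$ and $i\ge1$, $u_i(\lambda)=\mu$ if there is a partition $\mu$ with $\mu'_i=\lambda'_i+1$ and $\mu'_j=\lambda'_j$ for $j\ne i$ (adding a box in column $i$), and $u_i(\lambda)=0$ otherwise; $d_i(\lambda)=\mu$ if there is a partition $\mu$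 with $\mu'_i=\lambda'_i-1$ and $\mu'_j=\lambda'_j$ for $j\neq i$ (removing a box from column $i$), and $d_i(\lambda)=0$ otherwise. Here $1$ denotes the identity of $\mathcal U$. *)

(* Defs.v *)
From HB Require Import structures.
From mathcomp Require Import all_boot all_order all_algebra.
From mathcomp Require Import finmap.
From mathcomp Require Import boolp classical_sets reals.
From mathcomp Require Import complex.
From mathcomp Require Import monalg.

Set Implicit Arguments.
Unset Strict Implicit.
Unset Printing Implicit Defensive.

Import GRing.Theory.
Local Open Scope ring_scope.

(* A partition is encoded by the list of its nonzero parts. *)
Record partition := Partition {
  parts :> seq nat;
  partsP : sorted geq parts && (0%N \notin parts)
}.

HB.instance Definition _ := [isSub for parts].
HB.instance Definition _ := [Choice of partition by <:].

(* Columns are numbered from 0: [column lam i] is the conjugate part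
   lam'_(i+1), the number of rows of length at least i + 1. *)
Definition column (lam : partition) (i : nat) : nat :=
  count (fun r => i < r)%N lam.

Definition adds_box (i : nat) (lam mu : partition) : Prop :=
  column mu i = (column lam i).+1 /\
  forall j, j != i -> column mu j = column lam j.

(* [inl i] is the letter i + 1 and [inr i] the barred letter i + 1. *)
Notation Gamma := (nat + nat)%type.

Section SchurOperators.
Variable F : fieldType.

Notation CY := {malg F[partition]}.
Notation U := {malg F[{fmonom Gamma}]}.

Definition gen (a : Gamma) : U := << fmu a >>.
Definition u (i : nat) : U := gen (inl i).
Definition d (i : nat) : U := gen (inr i).

Definition basis_or_zero (P : partition -> Prop) : CY :=
  if pselect (exists mu, P mu) is left ex_mu then << sval (cid ex_mu) >> else 0.

(* mu'_i = lam'_i - 1 is written lam'_i = mu'_i + 1, because subtraction on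
   nat is truncated. *)
Definition letter_basis (a : Gamma) (lam : partition) : CY :=
  match a with
  | inl i => basis_or_zero (fun mu => adds_box i lam mu)
  | inr i => basis_or_zero (fun mu => adds_box i mu lam)
  end.

Definition letter_act (a : Gamma) (v : CY) : CY :=
  \sum_(lam <- msupp v) v@_lam *: letter_basis a lam.

(* The rightmost letter of the word acts first. *)
Definition word_act (w : {fmonom Gamma}) (v : CY) : CY := foldr letter_act v w.

Definition act (p : U) (v : CY) : CY :=
  \sum_(w <- msupp p) p@_w *: word_act w v.

Definition annihilator : set U := [set p | forall v, act p v = 0].

Inductive relator : set U :=
| relator_uu (i j : nat) : (2 <= `|i - j|)%N -> relator (u i * u j - u j * u i)
| relator_dd (i j : nat) : (2 <= `|i - j|)%N -> relator (d i * d j - d j * d i)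
| relator_du (i j : nat) : i != j -> relator (d i * u j - u j * d i)
| relator_du0 : relator (d 0 * u 0 - 1)
| relator_duS (i : nat) : relator (d i.+1 * u i.+1 - u i * d i).

End SchurOperators.

Arguments annihilator : clear implicits.
Arguments relator : clear implicits.

Definition two_sided_ideal (A : pzRingType) (I : set A) : Prop :=
  [/\ I 0,
      forall x y, I x -> I y -> I (x + y),
      forall a x, I x -> I (a * x)
    & forall a x, I x -> I (x * a)].

Definition ideal_generated (A : pzRingType) (S : set A) : set A :=
  smallest (@two_sided_ideal A) S.

(* Main.v *)
From HB Require Import structures.
Require Import Defs.
From mathcomp Require Import all_boot all_order all_algebra.
From mathcomp Require Import boolp classical_sets reals complex monalg.
From mathcomp Require Import finmap zify generic_quotient ring_quotient.

(** Let [a r] be the product [u (r - 1) ... u 1 u 0] and [b r] the product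
    [d 0 d 1 ... d (r - 1)]; on partitions, [a r] inserts a row of length
    [r] and [b r] deletes one. The relations alone imply that [b r * a r =
    1], that [a r] and [b r] commute with [a s] and [b s] for [s != r] (and
    all [a]s, as all [b]s, commute with each other), and that [u r = a (r +
    1) * b r] and [d r = a r * b (r + 1)]. The quotient by the relations is
    therefore spanned by the products [a lam * b mu] over pairs of
    partitions, where [a lam] is the product of the [a r] over the parts [r]
    of [lam]. These products act on partitions by linearly independent
    operators: [a lam * b mu] sends [mu] to [lam], and kills every other
    partition with at most as many parts as [mu]. *)

Set Implicit Arguments.
Unset Strict Implicit.
Unset Printing Implicit Defensive.

Import GRing.Theory.
Local Open Scope ring_scope.

(** * Rows from the relations *)

Fixpoint add_row (A : pzRingType) (u : nat -> A) (r : nat) : A :=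
  if r is r'.+1 then u r' * add_row u r' else 1.

Fixpoint remove_row (A : pzRingType) (d : nat -> A) (r : nat) : A :=
  if r is r'.+1 then remove_row d r' * d r' else 1.

Record schur_relations (A : pzRingType) (u d : nat -> A) : Prop := {
  schur_uu : forall i j : nat, (2 <= `|i - j|)%N -> GRing.comm (u i) (u j);
  schur_dd : forall i j : nat, (2 <= `|i - j|)%N -> GRing.comm (d i) (d j);
  schur_du : forall i j : nat, i != j -> GRing.comm (d i) (u j);
  schur_du0 : d 0%N * u 0%N = 1;
  schur_duS : forall i : nat, d i.+1 * u i.+1 = u i * d i
}.

(** Reversing products and exchanging the two families preserves the relations, so every consequence
    has a mirror image in the opposite ring. *)
Lemma schur_relations_converse (A : pzRingType) (u d : nat -> A) :
  schur_relations u d -> @schur_relations A^c d u.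
Proof.
case=> uu dd du du0 duS; split=> //.
- by move=> i j ij; apply/esym/dd.
- by move=> i j ij; apply/esym/uu.
- by move=> i j ij; apply: du; rewrite eq_sym.
Qed.

Section RowOperators.
Variables (A : pzRingType) (u d : nat -> A).
Hypothesis schur : schur_relations u d.

Notation a := (add_row u).
Notation b := (remove_row d).

Lemma distn_ge2 (i j : nat) : (i.+1 < j)%N -> (2 <= `|i - j|)%N.
Proof. by move=> ij; rewrite distnEr ?ltn_subRL ?addn1 // ltnW // ltnW. Qed.

Lemma comm_add_row x r :
  (forall i, (i < r)%N -> GRing.comm x (u i)) -> GRing.comm x (a r).
Proof.
elim: r => [|r IHr] xu /=; first exact: commr1.
by apply: commrM; [exact: xu | apply: IHr => i ir; apply/xu/ltnW].
Qed.

Lemma comm_remove_row x r :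
  (forall i, (i < r)%N -> GRing.comm x (d i)) -> GRing.comm x (b r).
Proof.
elim: r => [|r IHr] xd /=; first exact: commr1.
by apply: commrM; [apply: IHr => i ir; apply/xd/ltnW | exact: xd].
Qed.

Lemma comm_d_add_row j r : (r <= j)%N -> GRing.comm (d j) (a r).
Proof.
move=> rj; apply: comm_add_row => i ir; apply: (schur_du schur).
by rewrite gtn_eqF // (leq_trans ir).
Qed.

Lemma comm_u_remove_row j r : (r <= j)%N -> GRing.comm (u j) (b r).
Proof.
move=> rj; apply: comm_remove_row => i ir; apply/esym/(schur_du schur).
by rewrite ltn_eqF // (leq_trans ir).
Qed.

(** The letters of [a r] have index below [r], hence lie at distance at least two from [j]. *)
Lemma comm_u_add_row j r : (r < j)%N -> GRing.comm (u j) (a r).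
Proof.
move=> rj; apply: comm_add_row => i ir; apply/esym/(schur_uu schur)/distn_ge2.
exact: leq_ltn_trans rj.
Qed.

Lemma comm_d_remove_row j r : (r < j)%N -> GRing.comm (d j) (b r).
Proof.
move=> rj; apply: comm_remove_row => i ir; apply/esym/(schur_dd schur)/distn_ge2.
exact: leq_ltn_trans rj.
Qed.

(** The relation turns [d r.+1 * u r.+1] into [u r * d r]; the leading [u r] of [a r.+1] then
    completes [d r * u r * a r], which is absorbed by induction. *)
Lemma du_add_row r : d r * u r * a r = a r.
Proof.
elim: r => [|r IHr] /=; first by rewrite (schur_du0 schur) mulr1.
by rewrite (schur_duS schur) -mulrA (mulrA (d r)) IHr.
Qed.

Lemma remove_add_row r : b r * a r = 1.
Proof.
elim: r => [|r IHr] /=; first exact: mulr1.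
by rewrite -mulrA (mulrA (d r)) du_add_row.
Qed.

(* [d r * u r] is absorbed by [a r], and [u r * d r = d r.+1 * u r.+1] commutes
   with [b r]; inserting [1 = b r * a r] transfers the absorption to [u r]. *)
Lemma u_du r : u r * (d r * u r) = u r.
Proof.
have ud_b : GRing.comm (u r * d r) (b r).
  rewrite -(schur_duS schur); apply/commr_sym/commrM; apply: commr_sym.
    exact: comm_d_remove_row.
  exact/comm_u_remove_row/leqnSn.
have ub := comm_u_remove_row (leqnn r).
rewrite -[LHS]mulr1 -[in RHS](mulr1 (u r)) -(remove_add_row r).
rewrite mulrA (mulrA (u r)) -(mulrA (u r * d r)) ub mulrA ud_b.
by rewrite -!mulrA (mulrA (d r)) du_add_row !mulrA ub.
Qed.

(** Since [d r] commutes with [a r], [u r * a r * a r] equals [u r * d r * a r * u r * a r]. Now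
    [u r * d r], being [d r.+1 * u r.+1], moves past [a r], and [u_du] contracts the result to
    [a r * u r * a r]. *)
Lemma comm_add_row_succ r : GRing.comm (a r) (a r.+1).
Proof.
have ud_a : GRing.comm (u r * d r) (a r).
  rewrite -(schur_duS schur); apply/commr_sym/commrM; apply: commr_sym.
    exact/comm_d_add_row/leqnSn.
  exact: comm_u_add_row.
rewrite /GRing.comm /= -[RHS]mulrA -[X in _ = _ * (_ * X)](du_add_row r).
rewrite -[in RHS]mulrA [in RHS](mulrA (a r)) -(comm_d_add_row (leqnn r)).
by rewrite !mulrA ud_a -[X in _ * X * _ = _](u_du r) !mulrA.
Qed.

(** Adjacent lengths are the only hard case: once [r < s], the new factor [u s] of [a s.+1] commutes
    with [a r]. *)
Lemma comm_add_rows r s : GRing.comm (a r) (a s).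
Proof.
wlog rs : r s / (r <= s)%N.
  by case: (leqP r s) => [|/ltnW] rs; [| move=> H; apply/commr_sym]; auto.
elim: s rs => [|s IHs]; first by rewrite leqn0 => /eqP->.
rewrite leq_eqVlt ltnS => /predU1P[->//|rs].
have [->|ltrs] := eqVneq r s; first exact: comm_add_row_succ.
apply: commrM (IHs rs).
by apply/commr_sym/comm_u_add_row; rewrite ltn_neqAle ltrs.
Qed.

End RowOperators.

(** * The letters as products of rows *)

Section RowNormalForm.
Variables (A : pzRingType) (u d : nat -> A).
Hypothesis schur : schur_relations u d.
Let schur_c := schur_relations_converse schur.

Notation a := (add_row u).
Notation b := (remove_row d).

Lemma remove_row_converse r : b r = @add_row A^c d r.
Proof. by elim: r => //= r ->. Qed.

Lemma add_row_converse r : a r = @remove_row A^c u r.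
Proof. by elim: r => //= r ->. Qed.

Lemma comm_remove_rows r s : GRing.comm (b r) (b s).
Proof. by rewrite !remove_row_converse; apply/esym/(comm_add_rows schur_c). Qed.

Lemma du_d r : d r * u r * d r = d r.
Proof. exact: (u_du schur_c r). Qed.

(** The induction puts [d r * u r] between [u r] and [d r]; [u_du] collapses this to [u r * d r],
    which is [d r.+1 * u r.+1]. *)
Lemma add_remove_row r : a r * b r = d r * u r.
Proof.
elim: r => [|r IHr] /=; first by rewrite (schur_du0 schur) mulr1.
by rewrite mulrA -(mulrA (u r)) IHr (u_du schur) (schur_duS schur).
Qed.

(** Adding a box in column [r] replaces a row of length [r] by one of length [r + 1]. *)
Lemma u_rows r : u r = a r.+1 * b r.
Proof. by rewrite /= -mulrA add_remove_row (u_du schur). Qed.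

Lemma d_rows r : d r = a r * b r.+1.
Proof. by rewrite /= mulrA add_remove_row du_d. Qed.

(** For [s = r + 1] both products equal [d r]; each further factor of [b s] is a [d j] with [r < j],
    which commutes with [a r]. *)
Lemma comm_add_remove_row_lt r s : (r < s)%N -> GRing.comm (a r) (b s).
Proof.
elim: s => // s IHs; rewrite ltnS leq_eqVlt => /predU1P[<-|rs].
  rewrite /GRing.comm -d_rows /= -mulrA (comm_d_add_row schur (leqnn r)).
  by rewrite mulrA (remove_add_row schur) mul1r.
apply: commrM (IHs rs) _; apply/commr_sym/(comm_d_add_row schur).
exact: ltnW.
Qed.

End RowNormalForm.

(** * Normal ordering: insertions to the left of deletions *)

Section NormalForm.
Variables (A : pzRingType) (u d : nat -> A).
Hypothesis schur : schur_relations u d.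

Notation a := (add_row u).
Notation b := (remove_row d).

Lemma comm_add_remove_row r s : r != s -> GRing.comm (a r) (b s).
Proof.
rewrite neq_ltn => /orP[|sr]; first exact: comm_add_remove_row_lt.
(* The case [s < r] is the mirror image of the case [r < s]. *)
have := comm_add_remove_row_lt (schur_relations_converse schur) sr.
by rewrite -remove_row_converse -add_row_converse.
Qed.

Definition add_rows (s : seq nat) : A := \prod_(r <- s) a r.
Definition remove_rows (s : seq nat) : A := \prod_(r <- s) b r.

Lemma perm_commr_prod (f : nat -> A) (s t : seq nat) :
  (forall i j, GRing.comm (f i) (f j)) -> perm_eq s t ->
  \prod_(r <- s) f r = \prod_(r <- t) f r.
Proof.
move=> ff; elim: s t => [|x s IHs] t st.
  by move: (perm_size st) => /esym/size0nil ->.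
have xt : x \in t by rewrite -(perm_mem st) mem_head.
have E : \prod_(r <- t) f r = f x * \prod_(r <- rem x t) f r.
  elim: t xt {st IHs} => // y t IHt; rewrite inE /= big_cons.
  case: eqVneq => [->//|_] /= /IHt->.
  by rewrite big_cons !mulrA ff.
rewrite E big_cons (IHs (rem x t)) // -(perm_cons x).
exact: perm_trans st (perm_to_rem xt).
Qed.

Lemma prod_nonzero (f : nat -> A) (s : seq nat) :
  f 0%N = 1 -> \prod_(r <- s) f r = \prod_(r <- [seq r <- s | r != 0%N]) f r.
Proof.
move=> f0; elim: s => // x s IHs; rewrite big_cons /= IHs.
by case: eqVneq => [->|_] /=; rewrite ?f0 ?mul1r // big_cons.
Qed.

(** [b r] moves right through the rows of [s] until it cancels against an [a r] or, if there is
    none, joins the deletions. *)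
Lemma normal_form_remove r s t : exists s' t',
  b r * (add_rows s * remove_rows t) = add_rows s' * remove_rows t'.
Proof.
elim: s => [|x s [s' [t' IHs]]].
  by exists [::], (r :: t); rewrite /add_rows /remove_rows !big_nil !mul1r big_cons.
have [->|xr] := eqVneq x r.
  exists s, t; rewrite /add_rows big_cons !mulrA (remove_add_row schur).
  by rewrite mul1r.
exists (x :: s'), t'; rewrite /add_rows !big_cons -!mulrA -/(add_rows s').
by rewrite -IHs !mulrA -comm_add_remove_row.
Qed.

Lemma normal_form_add r s t :
  a r * (add_rows s * remove_rows t) = add_rows (r :: s) * remove_rows t.
Proof. by rewrite mulrA /add_rows big_cons. Qed.

Lemma normal_form_u r s t : exists s' t',
  u r * (add_rows s * remove_rows t) = add_rows s' * remove_rows t'.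
Proof.
rewrite (u_rows schur) -mulrA.
by have [s' [t' ->]] := normal_form_remove r s t; rewrite normal_form_add; eauto.
Qed.

Lemma normal_form_d r s t : exists s' t',
  d r * (add_rows s * remove_rows t) = add_rows s' * remove_rows t'.
Proof.
rewrite (d_rows schur) -mulrA.
have [s' [t' ->]] := normal_form_remove r.+1 s t.
by rewrite normal_form_add; eauto.
Qed.

End NormalForm.

Section RowMorphism.
Variables (A B : pzRingType) (f : {rmorphism A -> B}).

Lemma rmorph_add_rows (u : nat -> A) s : f (add_rows u s) = add_rows (f \o u) s.
Proof.
rewrite /add_rows rmorph_prod; apply: eq_bigr => r _.
by elim: r => [|r IHr] /=; rewrite ?rmorph1 // rmorphM IHr.
Qed.

Lemma rmorph_remove_rows (d : nat -> A) s :
  f (remove_rows d s) = remove_rows (f \o d) s.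
Proof.
rewrite /remove_rows rmorph_prod; apply: eq_bigr => r _.
by elim: r => [|r IHr] /=; rewrite ?rmorph1 // rmorphM IHr.
Qed.

End RowMorphism.

(** * Quotient by a two-sided ideal *)

Section IdealQuotient.
Variables (A : pzRingType) (J : set A).
Hypothesis idealJ : two_sided_ideal J.

Lemma ideal_opp x : J x -> J (- x).
Proof. by case: idealJ => _ _ JMl _ /(JMl (-1)); rewrite mulN1r. Qed.

Lemma ideal_sub x y : J x -> J y -> J (x - y).
Proof. by case: idealJ => _ JD _ _ Jx /ideal_opp; exact: JD. Qed.

Definition ideal_pred : {pred A} := fun x => `[<J x>].

Lemma ideal_zmod_closed : zmod_closed ideal_pred.
Proof.
split=> [|x y /asboolP Jx /asboolP Jy]; apply/asboolP; first by case: idealJ.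
exact: ideal_sub.
Qed.

HB.instance Definition _ := GRing.isZmodClosed.Build A ideal_pred ideal_zmod_closed.

Local Open Scope quotient_scope.

(** Only the additive quotient is formed here; the product, for a ring that need not be commutative,
    is added below. *)
Definition ideal_quot := Quotient.quot ideal_pred.

HB.instance Definition _ := GRing.Zmodule.on ideal_quot.
HB.instance Definition _ := EqQuotient.on ideal_quot.

Lemma ideal_quotP (x y : A) : \pi_ideal_quot x = \pi y <-> J (x - y).
Proof.
split=> [/eqP|Jxy]; first by rewrite -Quotient.idealrBE => /asboolP.
by apply/eqP; rewrite -Quotient.idealrBE; apply/asboolP.
Qed.

Definition quot_one : ideal_quot := \pi_ideal_quot 1.
Definition quot_mul (x y : ideal_quot) : ideal_quot := \pi_ideal_quot (repr x * repr y).

(** Independence of representatives uses both sides of the ideal: one term of the splitting is a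
    right multiple, the other a left multiple. *)
Lemma pi_quot_mul x y : \pi_ideal_quot (x * y) = quot_mul (\pi x) (\pi y).
Proof.
case: idealJ => _ JD JMl JMr; apply/ideal_quotP.
set x' := repr _; set y' := repr _.
have Jx : J (x - x') by apply/ideal_quotP; rewrite reprK.
have Jy : J (y - y') by apply/ideal_quotP; rewrite reprK.
have -> : x * y - x' * y' = (x - x') * y + x' * (y - y').
  by rewrite mulrBl mulrBr addrA subrK.
by apply: JD; [exact: JMr | exact: JMl].
Qed.

Lemma quot_mulA : associative quot_mul.
Proof.
move=> x y z; rewrite -[x]reprK -[y]reprK -[z]reprK.
by rewrite -!pi_quot_mul mulrA !reprK.
Qed.

Lemma quot_mul1 : left_id quot_one quot_mul.
Proof. by move=> x; rewrite -[x]reprK -pi_quot_mul mul1r. Qed.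

Lemma quot_mulr1 : right_id quot_one quot_mul.
Proof. by move=> x; rewrite -[x]reprK -pi_quot_mul mulr1. Qed.

Lemma quot_mulDl : left_distributive quot_mul +%R.
Proof.
move=> x y z; rewrite -[x]reprK -[y]reprK -[z]reprK.
by rewrite -raddfD -!pi_quot_mul -raddfD mulrDl.
Qed.

Lemma quot_mulDr : right_distributive quot_mul +%R.
Proof.
move=> x y z; rewrite -[x]reprK -[y]reprK -[z]reprK.
by rewrite -raddfD -!pi_quot_mul -raddfD mulrDr.
Qed.

HB.instance Definition _ := GRing.Zmodule_isPzRing.Build ideal_quot
  quot_mulA quot_mul1 quot_mulr1 quot_mulDl quot_mulDr.

Definition quot_class (x : A) : ideal_quot := \pi_ideal_quot x.

Lemma quot_class_zmod_morphism : zmod_morphism quot_class.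
Proof. by move=> x y; exact: raddfB. Qed.

Lemma quot_class_monoid_morphism : monoid_morphism quot_class.
Proof. by split=> //; exact: pi_quot_mul. Qed.

HB.instance Definition _ :=
  GRing.isZmodMorphism.Build A ideal_quot quot_class quot_class_zmod_morphism.
HB.instance Definition _ :=
  GRing.isMonoidMorphism.Build A ideal_quot quot_class quot_class_monoid_morphism.

Lemma quot_classP x y : quot_class x = quot_class y <-> J (x - y).
Proof. exact: ideal_quotP. Qed.

End IdealQuotient.

(** * Partitions as multisets of parts *)

Lemma sort_parts_subproof (s : seq nat) :
  let t := sort geq [seq r <- s | r != 0%N] in sorted geq t && (0%N \notin t).
Proof.
by rewrite /= sort_sorted ?mem_sort ?mem_filter // => m n; apply: leq_total.
Qed.

(** Any list of row lengths, unsorted or with zeros, names a partition, so row operations can be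
    written on plain lists. *)
Definition partition_of (s : seq nat) : Defs.partition :=
  Partition (sort_parts_subproof s).

Lemma zero_notin_parts (lam : Defs.partition) : 0%N \notin (lam : seq nat).
Proof. by case: lam => s /= /andP[]. Qed.

Lemma count_partition_of (p : pred nat) (s : seq nat) :
  ~~ p 0%N -> count p (partition_of s) = count p s.
Proof.
move=> p0; rewrite /partition_of /= count_sort count_filter; apply: eq_count => r.
by rewrite /=; case: eqVneq => [->|]; rewrite ?(negPf p0) ?andbF ?andbT.
Qed.

Lemma count_mem_partition_of r (s : seq nat) :
  r != 0%N -> count_mem r (partition_of s) = count_mem r s.
Proof. by move=> r0; rewrite count_partition_of //= eq_sym. Qed.

Lemma mem_partition_of r (s : seq nat) :
  r != 0%N -> (r \in (partition_of s : seq nat)) = (r \in s).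
Proof. by move=> r0; rewrite mem_sort mem_filter r0. Qed.

Lemma perm_partition_inj (lam mu : Defs.partition) :
  perm_eq lam mu -> lam = mu.
Proof.
move=> P; apply/val_inj.
case: lam mu P => [s /= /andP[ss _]] [t /= /andP[st _]] P.
by apply: (sorted_eq _ _ ss st) => // [m n k|m n]; rewrite /geq /=; lia.
Qed.

Lemma eq_partition_of (s t : seq nat) :
  (forall r, r != 0%N -> count_mem r s = count_mem r t) ->
  partition_of s = partition_of t.
Proof.
move=> st; apply: perm_partition_inj; apply/allP => r _; apply/eqP.
have [->|r0] := eqVneq r 0%N; first by rewrite !(count_memPn _) ?zero_notin_parts.
by rewrite !count_mem_partition_of ?st.
Qed.

Lemma partition_of_id (lam : Defs.partition) : partition_of lam = lam.
Proof.
apply: perm_partition_inj; rewrite perm_sort.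
have /all_filterP -> // : all (fun r => r != 0%N) lam.
by apply/allP => r rl; apply: contraNneq (zero_notin_parts lam) => <-.
Qed.

Lemma column_partition_of (s : seq nat) i :
  column (partition_of s) i = count (fun r => i < r)%N s.
Proof. exact: count_partition_of. Qed.

Lemma column_succ (lam : Defs.partition) i :
  column lam i = (column lam i.+1 + count_mem i.+1 lam)%N.
Proof.
rewrite /column; elim: (lam : seq nat) => //= r s ->.
by case: (ltngtP i.+1 r); lia.
Qed.

Lemma column_inj (lam mu : Defs.partition) :
  (forall i, column lam i = column mu i) -> lam = mu.
Proof.
move=> E; rewrite -[lam]partition_of_id -[mu]partition_of_id.
apply: eq_partition_of => [[//|r] _].
by move: (column_succ lam r) (column_succ mu r); rewrite !E; lia.
Qed.

Lemma count_mem_gt0 (s : seq nat) r : (0 < count_mem r s)%N = (r \in s).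
Proof. by rewrite -has_count has_pred1. Qed.

(** A box added in column [i] lengthens a row of length [i]. For [i = 0] this row is empty and
    always available, and [rem] then removes nothing. *)
Lemma adds_boxP i (lam mu : Defs.partition) :
  adds_box i lam mu <->
  ((i == 0%N) || (i \in (lam : seq nat))) /\ mu = partition_of (i.+1 :: rem i lam).
Proof.
have H : (i == 0%N) || (i \in (lam : seq nat)) ->
    adds_box i lam (partition_of (i.+1 :: rem i lam)).
  move=> il; split=> [|j ji].
    by rewrite column_partition_of /= ltnSn count_rem ltnn andbF subn0.
  rewrite column_partition_of /= count_rem /column.
  case: (boolP (i \in (lam : seq nat))) il => [il _|_]; last first.
    by rewrite orbF /= => /eqP i0; lia.
  have : (0 < count_mem i lam)%N by rewrite count_mem_gt0.
  have := column_succ lam i.-1; rewrite /column; move: il.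
  case: i ji => [|i] ji; first by rewrite (negPf (zero_notin_parts lam)).
  move=> /= il; rewrite ltnS.
  have : (j < i.+1 -> 0 < count (fun r => j < r)%N lam)%N.
    by move=> jl; rewrite -has_count; apply/hasP; exists i.+1.
  lia.
split=> [add|[il ->]]; last exact: H.
have il : (i == 0%N) || (i \in (lam : seq nat)).
  case: i {H} add => // i [addi addj]; apply/orP; right; rewrite -count_mem_gt0.
  (* Column [i.+1] of [mu] is at most its column [i], which is that of [lam]; so columns [i] and
     [i.+1] of [lam] differ, which forces a part [i.+1]. *)
  have := addj i; rewrite (ltn_eqF (ltnSn i)) => /(_ isT).
  by rewrite (column_succ lam) (column_succ mu) addi; lia.
split=> //; have [Hi Hj] := H il; have [addi addj] := add.
by apply: column_inj => j; have [->|ji] := eqVneq j i; rewrite ?Hi ?addi ?Hj ?addj.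
Qed.

(** Here [lam] is the larger partition. For [i = 0] the shortened row is empty and [partition_of]
    discards it. *)
Lemma removes_boxP i (lam mu : Defs.partition) :
  adds_box i mu lam <->
  i.+1 \in (lam : seq nat) /\ mu = partition_of (i :: rem i.+1 lam).
Proof.
have H : i.+1 \in (lam : seq nat) ->
    adds_box i (partition_of (i :: rem i.+1 lam)) lam.
  move=> il; have pos j : (j <= i)%N -> (0 < column lam j)%N.
    by move=> ji; rewrite -has_count; apply/hasP; exists i.+1.
  split=> [|j ji]; rewrite column_partition_of /= count_rem il -/(column lam _) /=.
    by rewrite ltnn ltnSn; have := pos i (leqnn i); lia.
  by rewrite ltnS; have := pos j; lia.
split=> [add|[il ->]]; last exact: H.
have [addi addj] := add.
have il : i.+1 \in (lam : seq nat).
  rewrite -count_mem_gt0; move: (addj i.+1 (negbT (gtn_eqF (ltnSn i)))).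
  by have := column_succ lam i; have := column_succ mu i; rewrite addi; lia.
split=> //; have [Hi Hj] := H il.
apply: column_inj => j; have [->|ji] := eqVneq j i; last by rewrite -Hj // addj.
by move: Hi; rewrite addi => -[].
Qed.

(** * The action on partitions *)

Lemma malg_add_ind (F : fieldType) (K : choiceType) (P : {malg F[K]} -> Prop) :
  P 0 -> (forall c k p, P p -> P (<< c *g k >> + p)) -> forall p, P p.
Proof.
move=> P0 PD p; rewrite (monalgE p); elim: {1}(enum_fset _) => [|k s IHs].
  by rewrite big_nil.
by rewrite big_cons; apply: PD.
Qed.

Lemma malgUZ (F : fieldType) (K : choiceType) (c : F) (k : K) :
  << c *g k >> = c *: << k >> :> {malg F[K]}.
Proof. by apply/malgP => k'; rewrite mcoeffZ !mcoeffU mulrnAr mulr1. Qed.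

(** * Linear maps given on a basis *)

Section LinearExtension.
Variables (F : fieldType) (K : choiceType) (V : lmodType F).
Implicit Types (f g : K -> V) (p : {malg F[K]}).

(** The sum has the shape of [letter_act] and [act], which are thus instances of it by
    conversion. *)
Definition lin_ext f p : V := \sum_(k <- msupp p) p@_k *: f k.

Lemma lin_extEw (D : {fset K}) f p : (msupp p `<=` D)%fset ->
  lin_ext f p = \sum_(k <- D) p@_k *: f k.
Proof.
move=> le; rewrite [LHS](big_fset_incl _ le) => //= x xd /mcoeff_outdom ->.
by rewrite scale0r.
Qed.

Lemma lin_ext_is_linear f : linear (lin_ext f).
Proof.
move=> c p q.
(* The three sums are compared over one finite set containing all three supports. *)
pose D := (msupp (c *: p + q) `|` (msupp p `|` msupp q))%fset.
have sub : [/\ msupp (c *: p + q) `<=` D, msupp p `<=` D & msupp q `<=` D]%fset.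
  by split; apply/fsubsetP => k; rewrite !inE => ->; rewrite ?orbT.
case: sub => s1 s2 s3; rewrite !(@lin_extEw D) // scaler_sumr -big_split /=.
by apply: eq_bigr => k _; rewrite mcoeffD mcoeffZ scalerDl scalerA.
Qed.

HB.instance Definition _ f :=
  GRing.isLinear.Build F {malg F[K]} V *:%R (lin_ext f) (lin_ext_is_linear f).

Lemma lin_extZU f c k : lin_ext f << c *g k >> = c *: f k.
Proof. by rewrite (lin_extEw _ msuppU_le) big_seq_fset1 mcoeffUU. Qed.

Lemma lin_extU f k : lin_ext f << k >> = f k.
Proof. by rewrite lin_extZU scale1r. Qed.

Lemma eq_linear (f g : {linear {malg F[K]} -> V}) :
  (forall k, f << k >> = g << k >>) -> f =1 g.
Proof.
move=> fg; apply: malg_add_ind => [|c k p IHp]; first by rewrite !linear0.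
by rewrite malgUZ !linearP fg IHp.
Qed.

End LinearExtension.

Lemma partition_of_perm (s t : seq nat) :
  perm_eq s t -> partition_of s = partition_of t.
Proof. by move=> /permP st; apply: eq_partition_of => r _; exact: st. Qed.

Lemma partition_of_cons r (s : seq nat) :
  partition_of (r :: partition_of s) = partition_of (r :: s).
Proof.
apply: eq_partition_of => k k0 /=; congr (_ + _)%N.
exact: count_mem_partition_of.
Qed.

Lemma partition_of_rem r (s : seq nat) :
  partition_of (rem r (partition_of s)) = partition_of (rem r s).
Proof.
apply: eq_partition_of => k k0; rewrite !count_rem.
rewrite count_mem_partition_of //; congr (_ - nat_of_bool _)%N.
by rewrite /=; have [->|_] := eqVneq r k; rewrite ?andbF // !andbT mem_partition_of.
Qed.

Lemma partition_of_cons0 (s : seq nat) : partition_of (0%N :: s) = partition_of s.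
Proof. by apply: eq_partition_of => k k0 /=; rewrite eq_sym (negPf k0). Qed.

Lemma mem_rem_neq (r s : nat) (t : seq nat) :
  r != s -> (r \in rem s t) = (r \in t).
Proof.
move=> rs; rewrite -!count_mem_gt0 count_rem /= eq_sym (negPf rs) andbF.
by rewrite subn0.
Qed.

Lemma perm_remC (r s : nat) (t : seq nat) :
  r != s -> perm_eq (rem r (rem s t)) (rem s (rem r t)).
Proof.
move=> rs; have sr : s != r by rewrite eq_sym.
by apply/permP => p; rewrite !count_rem !mem_rem_neq // subnAC.
Qed.

(** * Operators inserting and deleting a row *)

Section PartOperators.
Variable F : fieldType.
Notation CY := {malg F[Defs.partition]}.

Definition add_part (r : nat) : CY -> CY :=
  lin_ext (fun nu : Defs.partition => << partition_of (r :: nu) >>).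

(** An empty row can always be deleted, without effect: the case [r = 0] makes [remove_part 0] the
    identity. *)
Definition remove_part (r : nat) : CY -> CY :=
  lin_ext (fun nu : Defs.partition =>
    if (r == 0%N) || (r \in (nu : seq nat)) then << partition_of (rem r nu) >>
    else 0).

HB.instance Definition _ r := GRing.Linear.on (add_part r).
HB.instance Definition _ r := GRing.Linear.on (remove_part r).

Lemma add_partU r (s : seq nat) :
  add_part r << partition_of s >> = << partition_of (r :: s) >>.
Proof. by rewrite [LHS]lin_extU partition_of_cons. Qed.

Lemma remove_partU r (s : seq nat) :
  remove_part r << partition_of s >> =
  if (r == 0%N) || (r \in s) then << partition_of (rem r s) >> else 0.
Proof.
rewrite [LHS]lin_extU partition_of_rem.
by case: (eqVneq r 0%N) => //= r0; rewrite mem_partition_of.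
Qed.

Lemma add_part0 v : add_part 0%N v = v.
Proof.
apply: (eq_linear (f := add_part 0%N) (g := idfun)) => nu /=.
by rewrite [LHS]lin_extU partition_of_cons0 partition_of_id.
Qed.

Lemma remove_part0 v : remove_part 0%N v = v.
Proof.
apply: (eq_linear (f := remove_part 0%N) (g := idfun)) => nu /=.
by rewrite [LHS]lin_extU eqxx /= rem_id ?zero_notin_parts // partition_of_id.
Qed.

Lemma add_partC r s v : add_part r (add_part s v) = add_part s (add_part r v).
Proof.
apply: (eq_linear (f := add_part r \o add_part s)
                  (g := add_part s \o add_part r)) => nu /=.
rewrite -(partition_of_id nu) !add_partU; congr << _ >>.
by apply: partition_of_perm; rewrite (perm_catCA [:: r] [:: s]).
Qed.

Lemma remove_partC r s v :
  remove_part r (remove_part s v) = remove_part s (remove_part r v).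
Proof.
have [->//|rs] := eqVneq r s.
have sr : s != r by rewrite eq_sym.
apply: (eq_linear (f := remove_part r \o remove_part s)
                  (g := remove_part s \o remove_part r)) => nu /=.
rewrite -(partition_of_id nu) !remove_partU.
have Er : (r \in rem s nu) = (r \in (nu : seq nat)) by exact: mem_rem_neq.
have Es : (s \in rem r nu) = (s \in (nu : seq nat)) by exact: mem_rem_neq.
case: ifP => Hs; case: ifP => Hr; rewrite ?linear0 // !remove_partU ?Er ?Es ?Hr ?Hs //.
by rewrite (partition_of_perm (perm_remC _ rs)).
Qed.

Lemma remove_add_partC r s v : r != s ->
  remove_part r (add_part s v) = add_part s (remove_part r v).
Proof.
move=> rs; have sr : s != r by rewrite eq_sym.
apply: (eq_linear (f := remove_part r \o add_part s)
                  (g := add_part s \o remove_part r)) => nu /=.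
rewrite -(partition_of_id nu) add_partU !remove_partU /= inE (negPf rs) (negPf sr).
by case: ifP; rewrite ?linear0 // add_partU.
Qed.

Lemma remove_add_part r v : remove_part r (add_part r v) = v.
Proof.
apply: (eq_linear (f := remove_part r \o add_part r) (g := idfun)) => nu /=.
by rewrite -(partition_of_id nu) add_partU remove_partU inE eqxx orbT /= eqxx.
Qed.

(** At most one partition satisfies [P], so the choice inside [basis_or_zero] is forced. *)
Lemma basis_or_zeroE (P : Defs.partition -> Prop) (c : bool) mu :
  (forall mu', P mu' <-> c /\ mu' = mu) ->
  basis_or_zero F P = if c then << mu >> else 0.
Proof.
move=> PE; rewrite /basis_or_zero; case: pselect => [ex|nex].
  by case: cid => mu' /= /PE[-> ->].
by case: c PE => // PE; case: nex; exists mu; apply/PE.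
Qed.

(** By linearity this is [adds_boxP] on basis vectors; it is the operator counterpart of
    [u_rows]. *)
Lemma letter_act_inl i v : letter_act (inl i) v = add_part i.+1 (remove_part i v).
Proof.
apply: (eq_linear (f := lin_ext (letter_basis F (inl i)))
                  (g := add_part i.+1 \o remove_part i)) => nu /=.
rewrite lin_extU -[in RHS](partition_of_id nu) remove_partU /=.
rewrite (basis_or_zeroE (adds_boxP i nu)).
by case: ifP; rewrite ?linear0 // add_partU.
Qed.

Lemma letter_act_inr i v : letter_act (inr i) v = add_part i (remove_part i.+1 v).
Proof.
apply: (eq_linear (f := lin_ext (letter_basis F (inr i)))
                  (g := add_part i \o remove_part i.+1)) => nu /=.
rewrite lin_extU -[in RHS](partition_of_id nu) remove_partU /=.
rewrite (basis_or_zeroE (removes_boxP i nu)).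
by case: ifP; rewrite ?linear0 // add_partU.
Qed.

End PartOperators.

(** * The free algebra acting on partitions *)

Section Action.
Variable F : fieldType.
Notation CY := {malg F[Defs.partition]}.
Notation U := {malg F[{fmonom Gamma}]}.
Implicit Types (p q : U) (v : CY).

HB.instance Definition _ (a : Gamma) := GRing.isLinear.Build F CY CY *:%R
  (@letter_act F a) (lin_ext_is_linear (letter_basis F a)).

Lemma word_act_is_linear (w : {fmonom Gamma}) : linear (@word_act F w).
Proof.
rewrite /word_act => c v v'; elim: (w : seq Gamma) => //= a s ->.
exact: linearP.
Qed.

HB.instance Definition _ (w : {fmonom Gamma}) := GRing.isLinear.Build F CY CY *:%R
  (@word_act F w) (word_act_is_linear w).

Lemma act_lin_ext v p : act p v = lin_ext (@word_act F ^~ v) p.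
Proof. by []. Qed.

Lemma act_is_linear p : linear (act p).
Proof.
move=> c v v'; rewrite /act scaler_sumr -big_split /=; apply: eq_bigr => w _.
by rewrite linearP scalerDr !scalerA mulrC.
Qed.

HB.instance Definition _ p := GRing.isLinear.Build F CY CY *:%R
  (act p) (act_is_linear p).

Lemma actU c w v : act << c *g w >> v = c *: word_act w v.
Proof. exact: lin_extZU. Qed.

Lemma actD p q v : act (p + q) v = act p v + act q v.
Proof. by rewrite !act_lin_ext linearD. Qed.

Lemma actB p q v : act (p - q) v = act p v - act q v.
Proof. by rewrite !act_lin_ext linearB. Qed.

Lemma act0 v : act 0 v = 0.
Proof. by rewrite act_lin_ext linear0. Qed.

Lemma act1 v : act 1 v = v.
Proof. by rewrite [LHS]actU scale1r /word_act fm1. Qed.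

Lemma act_addr p v v' : act p (v + v') = act p v + act p v'.
Proof. exact: linearD. Qed.

Lemma actMUU c w c' w' v :
  act (<< c *g w >> * << c' *g w' >>) v = act << c *g w >> (act << c' *g w' >> v).
Proof.
rewrite malgM_def fgmulUU !actU [in RHS]linearZ /= scalerA.
by rewrite [in LHS]/word_act fmM foldr_cat.
Qed.

Lemma actMU c w q v : act (<< c *g w >> * q) v = act << c *g w >> (act q v).
Proof.
elim/malg_add_ind: q => [|c' w' q IHq]; first by rewrite mulr0 !act0 linear0.
rewrite mulrDr (actD (<< c *g w >> * _)) [X in X + _]actMUU IHq.
by rewrite (actD << c' *g w' >>) act_addr.
Qed.

Lemma actM p q v : act (p * q) v = act p (act q v).
Proof.
elim/malg_add_ind: p => [|c w p IHp]; first by rewrite mul0r !act0.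
by rewrite mulrDl (actD (_ * q)) [X in X + _]actMU IHp (actD << c *g w >>).
Qed.

Lemma act_gen a v : act (gen F a) v = letter_act a v.
Proof. by rewrite actU scale1r /word_act fmU. Qed.

Lemma act_u i v : act (u F i) v = add_part i.+1 (remove_part i v).
Proof. by rewrite act_gen letter_act_inl. Qed.

Lemma act_d i v : act (d F i) v = add_part i (remove_part i.+1 v).
Proof. by rewrite act_gen letter_act_inr. Qed.

Lemma annihilator_ideal : two_sided_ideal (annihilator F).
Proof.
split=> [v|x y Ix Iy v|a x Ix v|a x Ix v]; first exact: act0.
- by rewrite actD Ix Iy addr0.
- by rewrite actM Ix linear0.
- by rewrite actM Ix.
Qed.

Lemma annihilator_sub2 x y z t :
  (forall v, act x (act y v) = act z (act t v)) -> annihilator F (x * y - z * t).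
Proof. by move=> E v; rewrite /= (actB (x * y)) [X in X - _]actM E -actM subrr. Qed.

Lemma annihilator_sub1 x y :
  (forall v, act x (act y v) = v) -> annihilator F (x * y - 1).
Proof. by move=> E v; rewrite /= (actB (x * y)) (actM x y v) act1 E subrr. Qed.

(** In the commutation relators each inner deletion meets an insertion of a different length, so
    everything commutes. In the other two it meets its own length and cancels. *)
Lemma relator_annihilator : (relator F `<=` annihilator F)%classic.
Proof.
move=> _ [i j ij|i j ij|i j ij||i].
- apply: annihilator_sub2 => v; rewrite !act_u.
  rewrite (@remove_add_partC _ i); last by apply/eqP; lia.
  rewrite (@remove_add_partC _ j); last by apply/eqP; lia.
  by rewrite add_partC remove_partC.
- apply: annihilator_sub2 => v; rewrite !act_d.
  rewrite (@remove_add_partC _ i.+1); last by apply/eqP; lia.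
  rewrite (@remove_add_partC _ j.+1); last by apply/eqP; lia.
  by rewrite add_partC remove_partC.
- apply: annihilator_sub2 => v; rewrite !act_u !act_d.
  rewrite (@remove_add_partC _ i.+1); last by rewrite eqSS.
  rewrite (@remove_add_partC _ j); last by rewrite eq_sym.
  by rewrite add_partC remove_partC.
- apply: annihilator_sub1 => v.
  by rewrite act_d act_u remove_part0 add_part0 remove_add_part.
- apply: annihilator_sub2 => v.
  by rewrite !act_d !act_u !remove_add_part.
Qed.

Notation A := (add_row (u F)).
Notation B := (remove_row (d F)).

(** The product telescopes: each [u r] deletes the row of length [r] just inserted and inserts one
    of length [r + 1]. *)
Lemma act_add_row r v : act (A r) v = add_part r v.
Proof.
elim: r v => [|r IHr] v /=; first by rewrite act1 add_part0.
by rewrite actM IHr act_u remove_add_part.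
Qed.

Lemma act_remove_row r v : act (B r) v = remove_part r v.
Proof.
elim: r v => [|r IHr] v /=; first by rewrite act1 remove_part0.
by rewrite actM IHr act_d remove_add_part.
Qed.

(** * Linear independence of the normal words *)

Definition normal_word (s : Defs.partition * Defs.partition) : U :=
  add_rows (u F) s.1 * remove_rows (d F) s.2.

Lemma act_add_rows (s t : seq nat) :
  act (add_rows (u F) s) << partition_of t >> = << partition_of (s ++ t) >>.
Proof.
elim: s => [|r s IHs]; first by rewrite /add_rows big_nil act1.
by rewrite /add_rows big_cons actM IHs act_add_row add_partU.
Qed.

Lemma act_remove_rows (s t : seq nat) :
  act (remove_rows (d F) s) << partition_of (s ++ t) >> = << partition_of t >>.
Proof.
elim: s t => [|r s IHs] t; first by rewrite /remove_rows big_nil act1.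
rewrite /remove_rows big_cons actM.
have -> : partition_of ((r :: s) ++ t) = partition_of (s ++ r :: t).
  by apply: partition_of_perm; rewrite perm_sym perm_catC /= perm_cons perm_catC.
by rewrite IHs act_remove_row remove_partU mem_head orbT /= eqxx.
Qed.

(** Each deletion kills the vector or consumes an actual part. A zero in [s] would consume nothing
    and spoil the permutation. *)
Lemma act_remove_rows_sub (s : seq nat) (nu : Defs.partition) : 0%N \notin s ->
  act (remove_rows (d F) s) << nu >> = 0 \/
  exists t : Defs.partition, act (remove_rows (d F) s) << nu >> = << t >> /\
    perm_eq nu (s ++ t).
Proof.
elim: s => [|r s IHs]; first by right; exists nu; rewrite /remove_rows big_nil act1.
rewrite inE negb_or eq_sym => /andP[r0 /IHs]; rewrite /remove_rows big_cons actM.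
case=> [->|[t [-> nut]]]; first by left; rewrite linear0.
rewrite act_remove_row -(partition_of_id t) remove_partU (negPf r0) /=.
case: ifP => rt; [right | by left]; exists (partition_of (rem r t)); split=> //.
apply: (perm_trans nut); rewrite -cat_cons -[r :: s]/([:: r] ++ s).
rewrite -catA perm_sym perm_catCA perm_cat2l /= perm_sym.
apply: (perm_trans (perm_to_rem rt)); rewrite perm_cons perm_sym perm_sort.
suff /all_filterP -> : all (fun r => r != 0%N) (rem r t) by [].
by apply/allP => k /mem_rem; apply: contraTneq => ->; exact: zero_notin_parts.
Qed.

Lemma act_normal_word (lam mu : Defs.partition) :
  act (normal_word (lam, mu)) << mu >> = << lam >>.
Proof.
rewrite actM -[X in << X >>](partition_of_id mu) -[X in partition_of X]cats0.
by rewrite act_remove_rows act_add_rows cats0 partition_of_id.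
Qed.

(** A nonzero result requires [nu] to contain all parts of [mu], and the size bound leaves room for
    no others. *)
Lemma act_normal_word0 (lam mu nu : Defs.partition) :
  (size nu <= size mu)%N -> nu != mu ->
  act (normal_word (lam, mu)) << nu >> = 0.
Proof.
move=> le_size neq; rewrite actM.
case: (act_remove_rows_sub nu (zero_notin_parts mu)) => [->|[t [_ nut]]].
  by rewrite linear0.
case/eqP: neq; apply: perm_partition_inj.
move: nut (perm_size nut); rewrite size_cat.
case: (parts t) => [|r t'] /=; first by rewrite cats0.
lia.
Qed.

(* If the pairs whose second component has fewer parts than [mu] have coefficient
   zero, evaluating at [mu] isolates the pairs with second component [mu]. *)
Lemma normal_words_free (y : {malg F[(Defs.partition * Defs.partition)%type]}) :
  annihilator F (lin_ext normal_word y) -> y = 0.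
Proof.
move=> ann; apply/malgP => k; rewrite mcoeff0.
elim/ltn_ind: {k}(size k.2) {-2}k (erefl (size k.2)) => n IHn [lam mu] /= szn.
have [out|kin] := boolP ((lam, mu) \notin msupp y); first exact: mcoeff_outdom.
(* Taking the coefficient at [lam] singles out the first component as well. *)
have := congr1 (mcoeff lam) (ann << mu >>).
rewrite act_lin_ext [lin_ext normal_word y]/lin_ext linear_sum raddf_sum mcoeff0.
rewrite (bigD1_seq (lam, mu)) ?fset_uniq //=; last by rewrite negbK in kin.
rewrite big1 ?addr0 => [<-|[lam' mu'] ne].
  by rewrite linearZ /= -act_lin_ext act_normal_word mcoeffZ mcoeffUU mulr1.
(* The other terms vanish: by induction if [mu'] has fewer parts, by [lam' != lam] if [mu' = mu],
   and by [act_normal_word0] otherwise. *)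
rewrite linearZ /= -act_lin_ext mcoeffZ.
have [lt_sz|le_sz] := ltnP (size mu') n; first by rewrite (IHn _ lt_sz) ?mul0r.
have [eq_mu|ne_mu] := eqVneq mu mu'.
  rewrite -eq_mu act_normal_word mcoeffU; case: eqVneq => [eq_lam|_].
    by rewrite eq_mu eq_lam eqxx in ne.
  by rewrite mulr0n mulr0.
by rewrite act_normal_word0 ?szn // mcoeff0 mulr0.
Qed.

End Action.

(** * The presentation *)

Lemma ideal_generated_ideal (A : pzRingType) (S : set A) :
  two_sided_ideal (ideal_generated S).
Proof.
split=> [I [[]]//|x y Jx Jy I HI|a x Jx I HI|a x Jx I HI].
- by case: (HI) => [[_ ID _ _] _]; apply: ID; [exact: Jx | exact: Jy].
- by case: (HI) => [[_ _ IM _] _]; apply: IM; exact: Jx.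
- by case: (HI) => [[_ _ _ IM] _]; apply: IM; exact: Jx.
Qed.

Section RowProducts.
Variables (A : pzRingType) (u d : nat -> A).
Hypothesis schur : schur_relations u d.

(** Sorting is harmless because insertions commute, and dropping zeros because [add_row u 0] is 1;
    normal forms can thus be indexed by partitions. *)
Lemma add_rows_partition_of s : add_rows u (partition_of s) = add_rows u s.
Proof.
rewrite /add_rows (prod_nonzero s) //; apply: perm_commr_prod; last first.
  exact: permEl (perm_sort _ _).
exact: comm_add_rows schur.
Qed.

Lemma remove_rows_partition_of s : remove_rows d (partition_of s) = remove_rows d s.
Proof.
rewrite /remove_rows (prod_nonzero s) //; apply: perm_commr_prod; last first.
  exact: permEl (perm_sort _ _).
exact: comm_remove_rows schur.
Qed.

End RowProducts.

Section Presentation.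
Variable F : fieldType.
Notation U := {malg F[{fmonom Gamma}]}.
Notation J := (ideal_generated (relator F)).

Let idealJ : two_sided_ideal J := ideal_generated_ideal (relator F).

Notation Q := (ideal_quot idealJ).
Notation pi := (quot_class idealJ : U -> Q).
Notation qu := (pi \o u F).
Notation qd := (pi \o d F).

Lemma pi_relator2 x y z t :
  relator F (x * y - z * t) -> pi x * pi y = pi z * pi t.
Proof.
move=> rel; rewrite -2!rmorphM; apply/quot_classP.
exact: sub_smallest rel.
Qed.

Lemma pi_relator1 x y : relator F (x * y - 1) -> pi x * pi y = 1.
Proof.
move=> rel; rewrite -rmorphM -(rmorph1 pi); apply/quot_classP.
exact: sub_smallest rel.
Qed.

Lemma pi_schur : schur_relations qu qd.
Proof.
split=> [i j ij|i j ij|i j ij||i].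
- exact: pi_relator2 (relator_uu F ij).
- exact: pi_relator2 (relator_dd F ij).
- exact: pi_relator2 (relator_du F ij).
- exact: pi_relator1 (relator_du0 F).
- exact: pi_relator2 (relator_duS F i).
Qed.

(** Letters are prepended one at a time, and each step yields a single product, so no sums of normal
    words arise. *)
Lemma pi_word (w : seq Gamma) : exists s t,
  pi << FMonom w >> = add_rows qu s * remove_rows qd t.
Proof.
elim: w => [|a w [s [t IHw]]].
  exists [::], [::]; rewrite /add_rows /remove_rows !big_nil mulr1.
  by rewrite -(rmorph1 pi) -fmoneE.
have -> : << FMonom (a :: w) >> = gen F a * << FMonom w >> :> U.
  by rewrite malgM_def fgmulUU mulr1 /= fmuE; congr << _ >>; apply/esym/fmmulE.
rewrite rmorphM /= IHw; case: a => i.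
  exact: (normal_form_u pi_schur).
exact: (normal_form_d pi_schur).
Qed.

Lemma word_normal_form (w : {fmonom Gamma}) :
  exists k, J (<< w >> - normal_word F k).
Proof.
have [s [t E]] := pi_word w; exists (partition_of s, partition_of t).
apply/(quot_classP idealJ); rewrite fmK in E; rewrite E rmorphM.
rewrite rmorph_add_rows rmorph_remove_rows.
by rewrite (add_rows_partition_of pi_schur) (remove_rows_partition_of pi_schur).
Qed.

Lemma ideal_sub_annihilator : (J `<=` annihilator F)%classic.
Proof.
by apply: smallest_sub; [exact: annihilator_ideal | exact: relator_annihilator].
Qed.

(** Modulo [J] an annihilating [x] is a combination of normal words. As [J] annihilates, so does
    this combination, which is zero by [normal_words_free]. *)
Lemma annihilator_sub_ideal : (annihilator F `<=` J)%classic.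
Proof.
move=> x ann_x; have [J0 JD JMl _] := idealJ.
have [nf nfE] := choice word_normal_form.
(* [N] collects the coefficients of the words that share a chosen normal form. *)
pose N := lin_ext (fun w => << nf w >> : {malg F[(Defs.partition * Defs.partition)%type]}).
have JN p : J (p - lin_ext (normal_word F) (N p)).
  elim/malg_add_ind: p => [|c w p IHp]; first by rewrite /N linear0 /= linear0 subrr.
  rewrite /N linearD /= linearD /= opprD addrACA; apply: JD IHp.
  rewrite [X in lin_ext _ X]lin_extZU linearZ /= lin_extU.
  (* Scaling is left multiplication by a constant, so [J] is stable under it. *)
  by rewrite malgUZ -scalerBr -mul_malgC; apply: JMl.
suff N0 : N x = 0 by have := JN x; rewrite N0 linear0 subr0.
apply: normal_words_free => v.
have := ideal_sub_annihilator (JN x) v; rewrite actB ann_x sub0r.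
by move=> /eqP; rewrite oppr_eq0 => /eqP.
Qed.

Lemma annihilator_eq_ideal : annihilator F = J.
Proof.
apply/seteqP; split; [exact: annihilator_sub_ideal | exact: ideal_sub_annihilator].
Qed.

End Presentation.

Theorem theorem1p1 (R : realType) :
  annihilator R[i] = ideal_generated (relator R[i]).
Proof. exact: annihilator_eq_ideal. Qed.
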